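(* Let $H$ be a finite dimensional Hilbert space and let $K$ be a mapping cone in $\mathcal P(H)$ such that $K=K^t$. Then $\mathcal P_K(B(H))^\flat=\mathcal P_{K^\sharp}(B(H))$, so that $\mathcal P_K(B(H))=\mathcal P_{K^\sharp}(B(H))^\flat$.
   Context: $H$ is a finite dimensional complex Hilbert space; $\iota$ is the identity map on $B(H)$, $Tr$ the usual trace, $t$ the transpose map on $B(H)$ with respect to a fixed orthonormal basis of $H$ ($x^t=t(x)$), and $(e_{ij})$ the matrix units of $B(H)$ for that basis. $\mathcal P(H)$ is the set of positive linear maps $B(H)\to B(H)$. Cones are convex. A mapping cone is a nonzero closed cone $K\subset\mathcal P(H)$ such that $\phi\in K$ and $a,b\in B(H)$ imply that $x\mapsto a\phi(bxb^* )a^*$ belongs to $K$. $K^t=\{t\circ\phi\circ t:\phi\in K\}$; $\alpha^*$ is the adjoint, determined by $Tr(\alpha(a)b)=Tr(a\alpha^*(b))$. $C^K$ is the closed cone generated by all cones $(\iota\otimes\alpha^* )((B(H)\otimes B(H))^+)$, $\alpha\in K$, and $K^\sharp=\{\beta\in\mathcal P(H): (\iota\otimes\beta)(x)\ge0\ \forall x\in C^K\}$ (a mapping cone). For a mapping cone $L$, $P(B(H),L)=\{x\in B(H)\otimes B(H): (\iota\otimes\alpha)(x)\ge0\ \forall\alpha\in L\}$. For a linear map $\phi:B(H)\to B(H)$, $\tilde\phi$ is the linear functional on $B(H)\otimes B(H)$ with $\tilde\phi(a\otimes b)=Tr(\phi(a)b^t)$. A map $\phi\in\mathcal P(H)$ is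 $L$-positive if $\tilde\phi\ge0$ on $P(B(H),L)$, and $\mathcal P_L(B(H))$ is the cone of $L$-positive maps. $C_\phi=\sum_{ij}e_{ij}\otimes\phi(e_{ij})$ is the Choi matrix, and for a set $S\subset\mathcal P(H)$ the dual cone $S^\flat$ is the set of linear maps $\phi:B(H)\to B(H)$ with $Tr(C_\phi C_\psi)\ge0$ for all $\psi\in S$. *)

(* Defs.v *)
From HB Require Import structures.
From mathcomp Require Import all_boot all_order all_algebra.
From mathcomp Require Import all_classical all_reals all_analysis.
From mathcomp Require Import complex mxtens ring.
Set Implicit Arguments. Unset Strict Implicit. Unset Printing Implicit Defensive.
Import Order.TTheory GRing.Theory Num.Theory.
Import numFieldNormedType.Exports.
Local Open Scope classical_set_scope.
Local Open Scope ring_scope.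
Local Open Scope sesquilinear_scope.

(* The Hilbert space is C^n with its standard orthonormal basis, so B(H) is
   'M[C]_n, the matrix units are [delta_mx i j], the transpose map is [trmx],
   and B(H) (x) B(H) is 'M[C]_(n * n), with [a *t b] the elementary tensor.
   The scalars C are kept abstract here only because the norm topology is
   inferred from a [numClosedFieldType]; they are meant to be R[i], R real. *)

Section Cones.
Variable C : numClosedFieldType.

(* In a numClosedFieldType, [0 <= z] says that z is real and nonnegative; in
   particular a [psd] matrix is Hermitian. *)
Definition psd m : set 'M[C]_m :=
  [set A | forall v : 'cV[C]_m, 0 <= (v ^t* *m A *m v) 0 0].

Definition convex_cone (V : lmodType C) (S : set V) :=
  [/\ S 0, forall x y, S x -> S y -> S (x + y)
    & forall t x, 0 <= t -> S x -> S (t *: x)].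

Definition closed_cone_gen m (S : set 'M[C]_m) : set 'M[C]_m :=
  \bigcap_(D in [set D : set 'M[C]_m |
                 [/\ convex_cone D, closed D & S `<=` D]]) D.

End Cones.

Section Maps.
Variables (C : numClosedFieldType) (n : nat).
Local Notation M := 'M[C]_n.
Local Notation MM := 'M[C]_(n * n).

Definition positive_map : set (M -> M) :=
  [set phi | linear phi /\ forall x, psd x -> psd (phi x)].

(* All vector topologies on the finite-dimensional space of linear maps agree;
   closedness is expressed with pointwise convergence, for which the linear
   maps form a closed subset of all functions. *)
Definition mapping_cone (K : set (M -> M)) :=
  [/\ K `<=` positive_map,
      convex_cone K,
      (exists2 phi, K phi & phi <> 0),
      closed (K : set {ptws M -> M})
    & forall phi (a b : M), K phi ->
        K (fun x => a *m phi (b *m x *m b ^t*) *m a ^t*)].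

Definition transpose_cone (K : set (M -> M)) : set (M -> M) :=
  [set (fun x : M => (phi x^T)^T) | phi in K].

(* The entry formula is the trace identity of [adjointP] at a = e_ji. *)
Definition adjoint (alpha : M -> M) : M -> M :=
  fun b => \matrix_(i, j) \tr (alpha (delta_mx j i) *m b).

Definition block (x : MM) (i j : 'I_n) : M :=
  \matrix_(k, l) x (mxtens_index (i, k)) (mxtens_index (j, l)).

(* iota (x) alpha, computed on x = \sum_(i, j) e_ij (x) x_ij; cf. [tens_blockE] and
   [id_tens_tensmx] *)
Definition id_tens (alpha : M -> M) (x : MM) : MM :=
  \sum_i \sum_j delta_mx i j *t alpha (block x i j).

Definition CK (K : set (M -> M)) : set MM :=
  closed_cone_gen
    (\bigcup_(alpha in K) (id_tens (adjoint alpha) @` @psd C (n * n))).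

Definition sharp (K : set (M -> M)) : set (M -> M) :=
  [set beta | positive_map beta /\ forall x, CK K x -> psd (id_tens beta x)].

Definition Pcone (L : set (M -> M)) : set MM :=
  [set x | forall alpha, L alpha -> psd (id_tens alpha x)].

(* The functional a (x) b |-> Tr (phi(a) b^t), computed on
   x = \sum_(i, j) e_ij (x) x_ij; cf. [tilde_tensmx] *)
Definition tilde (phi : M -> M) (x : MM) : C :=
  \sum_i \sum_j \tr (phi (delta_mx i j) *m (block x i j)^T).

Definition Lpositive (L : set (M -> M)) : set (M -> M) :=
  [set phi | positive_map phi /\ forall x, Pcone L x -> 0 <= tilde phi x].

Definition choi (phi : M -> M) : MM :=
  \sum_i \sum_j delta_mx i j *t phi (delta_mx i j).

Definition dual_cone (S : set (M -> M)) : set (M -> M) :=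
  [set phi | linear phi /\
     forall psi, S psi -> 0 <= \tr (choi phi *m choi psi)].

Lemma block_tensmx (a b : M) i j : block (a *t b) i j = a i j *: b.
Proof. by apply/matrixP => k l; rewrite !mxE !mxtens_indexK. Qed.

Lemma block_linear i j : linear (fun x => block x i j).
Proof. by move=> c x y; apply/matrixP => k l; rewrite !mxE. Qed.

Lemma linear_sumZ (W : lmodType C) (f : M -> W) (a : M) : linear f ->
  f a = \sum_i \sum_j a i j *: f (delta_mx i j).
Proof.
move=> flin; pose F := GRing.isLinear.Build C M W *:%R f flin.
pose g : {linear M -> W} := HB.pack f F.
rewrite -[f]/(g : M -> W) {1}[a]matrix_sum_delta linear_sum.
apply: eq_bigr => i _; rewrite linear_sum; apply: eq_bigr => j _.
by rewrite linearZ.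
Qed.

Lemma tens_blockE (x : MM) :
  x = \sum_i \sum_j delta_mx i j *t block x i j.
Proof.
apply/matrixP => p q; case: (mxtens_indexP p) => i k.
case: (mxtens_indexP q) => j l; rewrite summxE (bigD1 i) //= summxE (bigD1 j) //=.
rewrite big1 => [|j' nj]; last first.
  by rewrite tensmxE mxE (eq_sym j) (negPf nj) andbF mul0r.
rewrite big1 => [|i' ni]; last first.
  rewrite summxE big1 // => j' _.
  by rewrite tensmxE mxE eq_sym (negPf ni) mul0r.
by rewrite !addr0 tensmxE !mxE !eqxx mul1r.
Qed.

Lemma adjointP (alpha : M -> M) (a b : M) : linear alpha ->
  \tr (alpha a *m b) = \tr (a *m adjoint alpha b).
Proof.
move=> lin; have lin' : linear (fun a => \tr (alpha a *m b) : C^o).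
  by move=> c x y; rewrite lin mulmxDl -scalemxAl mxtraceD mxtraceZ.
rewrite (linear_sumZ a lin') /mxtrace; apply: eq_bigr => i _.
by rewrite !mxE; apply: eq_bigr => j _; rewrite !mxE.
Qed.

Lemma adjoint_uniq (alpha beta : M -> M) : linear alpha ->
  (forall a b, \tr (alpha a *m b) = \tr (a *m beta b)) -> beta = adjoint alpha.
Proof.
move=> lin h; apply/funext => b; apply/matrixP => i j; rewrite mxE h.
rewrite /mxtrace (bigD1 j) //= mxE (bigD1 i) //=.
rewrite big1 => [|k nk]; last by rewrite mxE (negPf nk) andbF mul0r.
rewrite big1 => [|k nk]; last first.
  by rewrite mxE big1 // => l _; rewrite mxE (negPf nk) mul0r.
by rewrite !addr0 mxE !eqxx mul1r.
Qed.

Lemma id_tens_tensmx (alpha : M -> M) (a b : M) : linear alpha ->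
  id_tens alpha (a *t b) = a *t alpha b.
Proof.
move=> lin; rewrite /id_tens.
have h : linear (fun a : M => a *t alpha b).
  move=> c x y; apply/matrixP => k l; rewrite !mxE; ring.
rewrite (linear_sumZ a h); apply: eq_bigr => i _; apply: eq_bigr => j _.
rewrite block_tensmx.
have a0 : alpha 0 = 0.
  by have := lin (-1) 0 0; rewrite scaler0 addr0 scaleN1r addNr.
have -> : alpha (a i j *: b) = a i j *: alpha b.
  by rewrite -[_ *: b]addr0 lin a0 addr0.
by apply/matrixP => k l; rewrite !mxE; ring.
Qed.

Lemma id_tens_linear (alpha : M -> M) : linear alpha -> linear (id_tens alpha).
Proof.
move=> lin c x y; rewrite /id_tens scaler_sumr -big_split.
apply: eq_bigr => i _ /=; rewrite scaler_sumr -big_split.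
apply: eq_bigr => j _ /=; rewrite block_linear lin.
by apply/matrixP => k l; rewrite !mxE; ring.
Qed.

Lemma tilde_tensmx (phi : M -> M) (a b : M) : linear phi ->
  tilde phi (a *t b) = \tr (phi a *m b^T).
Proof.
move=> lin; have lin' : linear (fun a => \tr (phi a *m b^T) : C^o).
  by move=> c x y; rewrite lin mulmxDl -scalemxAl mxtraceD mxtraceZ.
rewrite (linear_sumZ a lin'); apply: eq_bigr => i _; apply: eq_bigr => j _.
by rewrite block_tensmx linearZ -scalemxAr mxtraceZ.
Qed.

Lemma tilde_linear (phi : M -> M) : linear (tilde phi : MM -> C^o).
Proof.
move=> c x y; rewrite /tilde scaler_sumr -big_split.
apply: eq_bigr => i _ /=; rewrite scaler_sumr -big_split.
apply: eq_bigr => j _ /=.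
by rewrite block_linear linearP mulmxDr -scalemxAr mxtraceD mxtraceZ.
Qed.

End Maps.

(* Main.v *)
(* Pair matrices by Tr (x y) and write P for P(B(H), K).  The key point is that
   sharp K contains the adjoint of every phi with Choi matrix in P: for v v^* of
   rank one, (iota (x) phi)(v v^* ) = (a (x) 1) C_phi (a (x) 1)^* again lies in P,
   and P pairs nonnegatively with C^K.  Since
   Tr (C_phi x) = Tr (C_iota ((iota (x) phi^* ) x)) with C_iota >= 0,
   P pairs nonnegatively with P(B(H), sharp K), while the generators of C^K lie in
   P(B(H), sharp K).  As P is stable under transposition, it follows that both
   dual_cone (Lpositive K) and Lpositive (sharp K) consist of the linear maps with
   Choi matrix in P, so no separation theorem is needed. *)
Require Import Defs.
From mathcomp Require Import all_boot all_order all_algebra.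
From mathcomp Require Import all_classical all_reals all_analysis.
From mathcomp Require Import complex mxtens ring.
Import Order.TTheory GRing.Theory Num.Theory.
Import numFieldNormedType.Exports.
Local Open Scope classical_set_scope.
Local Open Scope ring_scope.
Local Open Scope sesquilinear_scope.

Set Implicit Arguments. Unset Strict Implicit. Unset Printing Implicit Defensive.

(** * Positive semidefinite matrices and the rank-one matrices v v^* *)

Section PositiveMatrices.
Variable C : numClosedFieldType.

Definition ketbra m (v : 'cV[C]_m) : 'M[C]_m := v *m v ^t*.

Lemma mulmx_linear m p (A B : 'M[C]_m) (f : 'M[C]_p -> 'M[C]_m) : linear f ->
  linear (fun x => A *m f x *m B).
Proof.
by move=> lin c x y; rewrite lin mulmxDr mulmxDl -scalemxAr -scalemxAl.
Qed.

Lemma trmul_linear m (A : 'M[C]_m) : linear (fun x => \tr (A *m x) : C^o).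
Proof. by move=> c x y; rewrite mulmxDr -scalemxAr mxtraceD mxtraceZ. Qed.

Section UnbundledLinear.
Variables (V W : lmodType C) (f : V -> W).
Hypothesis flin : linear f.

Lemma linear_fun0 : f 0 = 0.
Proof. by have := flin (-1) 0 0; rewrite scaler0 addr0 scaleN1r addNr. Qed.

Lemma linear_funD x y : f (x + y) = f x + f y.
Proof. by have := flin 1 x y; rewrite !scale1r. Qed.

Lemma linear_funZ c x : f (c *: x) = c *: f x.
Proof. by have := flin c x 0; rewrite linear_fun0 !addr0. Qed.

Lemma linear_fun_sum I (r : seq I) (P : pred I) (F : I -> V) :
  f (\sum_(i <- r | P i) F i) = \sum_(i <- r | P i) f (F i).
Proof. exact: (big_morph f linear_funD linear_fun0). Qed.

End UnbundledLinear.

Lemma mxtrace_mul_ketbra m (A : 'M[C]_m) (v : 'cV[C]_m) :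
  \tr (A *m ketbra v) = (v ^t* *m A *m v) 0 0.
Proof. by rewrite /ketbra mulmxA mxtrace_mulC mulmxA /mxtrace big_ord1. Qed.

Lemma psdP m (A : 'M[C]_m) :
  psd A <-> forall v, 0 <= \tr (A *m ketbra v).
Proof. by split=> h v; have := h v; rewrite mxtrace_mul_ketbra. Qed.

Lemma psd_ketbra m (v : 'cV[C]_m) : psd (ketbra v).
Proof.
move=> w; rewrite /ketbra mulmxA -mulmxA mxE big_ord1.
have -> : (v ^t* *m w) 0 0 = Num.conj ((w ^t* *m v) 0 0).
  rewrite !mxE rmorph_sum; apply: eq_bigr => i _.
  by rewrite !mxE rmorphM /= conjCK mulrC.
exact: mul_conjC_ge0.
Qed.

Lemma psdD m (A B : 'M[C]_m) : psd A -> psd B -> psd (A + B).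
Proof.
by move=> hA hB v; rewrite mulmxDr mulmxDl mxE addr_ge0 // ?hA ?hB.
Qed.

Lemma psd0 m : psd (0 : 'M[C]_m).
Proof. by move=> v; rewrite mulmx0 mul0mx mxE. Qed.

Lemma psd_sum m I (r : seq I) (P : pred I) (F : I -> 'M[C]_m) :
  (forall i, P i -> psd (F i)) -> psd (\sum_(i <- r | P i) F i).
Proof. by move=> h; apply: big_ind => //; [exact: psd0 | exact: psdD]. Qed.

Lemma psd_tr m (A : 'M[C]_m) : psd A -> psd A^T.
Proof.
(* The scalar v^* A^T v equals its own transpose, which is the quadratic form of A at the conjugate
   of v. *)
move=> hA v; have := hA (map_mx Num.conj v).
congr (0 <= _); rewrite -[in RHS](trmxK (_ *m _ *m _)) [RHS]mxE.
rewrite !trmx_mul trmxK mulmxA; congr ((_ *m _) 0 0).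
  congr (_ *m _); apply/matrixP => i j; rewrite !mxE; exact: conjCK.
by apply/matrixP => i j; rewrite !mxE.
Qed.

(** The vectors e_k + c e_l give c f(e_lk) + conj(c) f(e_kl) = 0 for every scalar c, and two values
    of c separate the terms. *)
Lemma polarization_eq0 m (W : lmodType C) (f : 'M[C]_m -> W) :
  linear f -> (forall v, f (ketbra v) = 0) -> forall a, f a = 0.
Proof.
move=> flin f0 a; rewrite (linear_sumZ a flin) big1 // => i _.
rewrite big1 // => j _.
suff -> : f (delta_mx i j) = 0 by rewrite scaler0.
have h (k l : 'I_m) c : c *: f (delta_mx l k) + c^* *: f (delta_mx k l) = 0.
  have := f0 (delta_mx k 0 + c *: delta_mx l 0).
  have e k' l' : delta_mx k' 0 *m delta_mx 0 l' = delta_mx k' l' :> 'M[C]_m.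
    by rewrite mul_delta_mx.
  have -> : ketbra (delta_mx k 0 + c *: delta_mx l 0) =
    ketbra (delta_mx k 0) + (c * c^*) *: ketbra (delta_mx l 0)
     + (c *: delta_mx l k + c^* *: delta_mx k l).
    have d0 k' : (delta_mx k' 0 : 'cV[C]_m) ^t* = delta_mx 0 k'.
      by rewrite trmx_delta map_delta_mx.
    have dD : (delta_mx k 0 + c *: delta_mx l 0 : 'cV[C]_m) ^t* =
       delta_mx 0 k + c^* *: delta_mx 0 l.
      by rewrite linearD linearZ /= map_mxD map_mxZ !d0.
    rewrite /ketbra dD !d0 !mulmxDl !mulmxDr -!scalemxAr -!scalemxAl !e.
    by apply/matrixP => p q; rewrite !mxE; ring.
  by rewrite !(linear_funD flin) !(linear_funZ flin) !f0 scaler0 !add0r.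
(* Taking c = i yields f(e_ij) = f(e_ji); taking c = 1 then makes twice this value vanish. *)
have := h i j 'i; rewrite conjCi scaleNr -scalerBr => /eqP.
rewrite scaler_eq0 (negPf (neq0Ci _)) subr_eq0 => /eqP fji.
have := h i j 1; rewrite conjC1 !scale1r fji -mulr2n -scaler_nat => /eqP.
by rewrite scaler_eq0 pnatr_eq0 => /eqP.
Qed.

Lemma mxtrace_mul_delta m (A : 'M[C]_m) i j : \tr (A *m delta_mx j i) = A i j.
Proof.
rewrite /mxtrace (bigD1 i) //= mxE (bigD1 j) //= !big1.
- by rewrite !addr0 !mxE !eqxx mulr1.
- by move=> k nk; rewrite mxE big1 // => l _; rewrite !mxE (negPf nk) andbF mulr0.
- by move=> k nk; rewrite !mxE (negPf nk) mulr0.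
Qed.

(** Spectral theorem, with each eigenvector scaled by the square root of its eigenvalue. It reduces
    positivity arguments to rank-one matrices. *)
Lemma psd_sum_ketbra m (A : 'M[C]_m) : psd A ->
  exists w : 'I_m -> 'cV[C]_m, A = \sum_i ketbra (w i).
Proof.
move=> hA.
(* The quadratic form of A is real, so that of A^* - A vanishes and polarization applies. *)
have hermA : A ^t* = A.
  apply/eqP; rewrite -subr_eq0; apply/eqP; apply/matrixP => i j.
  pose f (x : 'M[C]_m) := \tr ((A ^t* - A) *m x) : C^o.
  have fl : linear f by exact: trmul_linear.
  have f0 v : f (ketbra v) = 0.
    rewrite /f mulmxBl linearB /= !mxtrace_mul_ketbra.
    apply/eqP; rewrite subr_eq0; apply/eqP.
    rewrite -(CrealP (ger0_real (hA v))).
    have -> : v ^t* *m A ^t* *m v = (v ^t* *m A *m v) ^t*.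
      by rewrite !trmx_mul !map_mxM /= trmxCK mulmxA.
    by rewrite !mxE.
  by rewrite [RHS]mxE -[LHS]mxtrace_mul_delta; exact: polarization_eq0 fl f0 _.
have /orthomx_spectralP : A \is normalmx by apply/normalmxP; rewrite hermA.
have U := spectral_unitarymx A; rewrite (invmx_unitary U).
set P := spectralmx A in U *; set d := spectral_diag A => Aeq.
have d_ge0 i : 0 <= d 0 i.
  have := hA (P ^t* *m delta_mx i 0).
  rewrite {1}Aeq !trmx_mul map_mxM /= trmxCK !mulmxA.
  rewrite !(mulmxtVK _ U).
  rewrite trmx_delta map_delta_mx -rowE -colE !mxE eqxx mulr1n //.
exists (fun i => sqrtC (d 0 i) *: (P ^t* *m delta_mx i 0)).
have kb i : ketbra (sqrtC (d 0 i) *: (P ^t* *m delta_mx i 0)) =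
   P ^t* *m (d 0 i *: delta_mx i i) *m P.
  have sr : (sqrtC (d 0 i))^* = sqrtC (d 0 i).
    by apply: CrealP; apply: ger0_real; rewrite sqrtC_ge0.
  rewrite /ketbra linearZ /= map_mxZ /= sr -scalemxAl -scalemxAr scalerA -expr2 sqrtCK.
  rewrite trmx_mul map_mxM trmxCK trmx_delta map_delta_mx.
  rewrite mulmxA -(mulmxA (P ^t*) (delta_mx i 0)) mul_delta_mx -scalemxAr -scalemxAl //.
rewrite (eq_bigr _ (fun i _ => kb i)) -mulmx_suml -mulmx_sumr.
rewrite {1}Aeq; congr (_ *m _ *m _); exact: diag_mx_sum_delta.
Qed.

Lemma mxtrace_mul_psd_ge0 m (A B : 'M[C]_m) : psd A -> psd B -> 0 <= \tr (A *m B).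
Proof.
move=> hA /psd_sum_ketbra[w ->]; rewrite mulmx_sumr linear_sum /=.
by apply: sumr_ge0 => i _; exact: (psdP A).1.
Qed.

(** Together with [closed_ge0], this makes the half-spaces Tr (x y) >= 0 closed, as needed to
    compare them with [CK]. *)
Lemma linear_continuous_mx m (f : 'M[C]_m -> C) :
  linear (f : 'M[C]_m -> C^o) -> continuous f.
Proof.
move=> flin.
have -> : f = fun x => \sum_i \sum_j x i j * f (delta_mx i j).
  by apply/funext => x; rewrite (linear_sumZ x flin).
have csum (I : Type) (r : seq I) (g : I -> 'M[C]_m -> C) :
    (forall i, continuous (g i)) -> continuous (fun x => \sum_(i <- r) g i x).
  move=> gc x; elim: r => [|i r IH].
    rewrite (_ : (fun y => _) = fun=> 0); first exact: cst_continuous.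
    by apply/funext => y; rewrite big_nil.
  rewrite (_ : (fun y => _) = fun y => g i y + \sum_(i <- r) g i y).
    exact: (cvgD (gc i x) IH).
  by apply/funext => y; rewrite big_cons.
apply: (csum) => i; apply: (csum) => j x.
exact: (cvgMr_tmp (@coord_continuous C m m i j x)).
Qed.

Lemma closed_ge0 : closed [set z : C | 0 <= z].
Proof.
rewrite (_ : [set z | _] = (fun z : C => `|z| - z) @^-1` [set 0]).
  apply: preimage_closed => [z _|].
    exact: (cvgB (@norm_continuous C C z) (@cvg_id _ (nbhs z))).
  by apply: accessible_closed_set1; apply: hausdorff_accessible; exact: norm_hausdorff.
apply/seteqP; split=> z /=; first by move=> z0; rewrite ger0_norm ?subrr.
by move/eqP; rewrite subr_eq0 => /eqP <-.
Qed.

End PositiveMatrices.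

(** * Block calculus on B(H) (x) B(H): Choi matrices and trace pairings *)

Section Blocks.
Variables (C : numClosedFieldType) (n : nat).
Local Notation M := 'M[C]_n.
Local Notation MM := 'M[C]_(n * n).

Lemma linear_comp_fun (U V W : lmodType C) (f : V -> W) (g : U -> V) :
  linear f -> linear g -> linear (f \o g).
Proof. by move=> fl gl c x y /=; rewrite gl fl. Qed.

Lemma block_inj (x y : MM) : (forall i j, block x i j = block y i j) -> x = y.
Proof.
move=> h; rewrite (tens_blockE x) (tens_blockE y).
by apply: eq_bigr => i _; apply: eq_bigr => j _; rewrite h.
Qed.

Lemma block_sum_delta (F : 'I_n -> 'I_n -> M) i j :
  block (\sum_i' \sum_j' delta_mx i' j' *t F i' j') i j = F i j.
Proof.
rewrite (linear_fun_sum (block_linear i j)) (bigD1 i) //=.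
rewrite (linear_fun_sum (block_linear i j)) (bigD1 j) //=.
rewrite block_tensmx mxE !eqxx scale1r big1 => [|j' nj]; last first.
  by rewrite block_tensmx mxE (eq_sym j) (negPf nj) andbF scale0r.
rewrite big1 => [|i' ni]; first by rewrite !addr0.
rewrite (linear_fun_sum (block_linear i j)) big1 // => j' _.
by rewrite block_tensmx mxE eq_sym (negPf ni) scale0r.
Qed.

Lemma block_id_tens (alpha : M -> M) (x : MM) i j :
  block (id_tens alpha x) i j = alpha (block x i j).
Proof. exact: (block_sum_delta (fun i j => alpha (block x i j))). Qed.

Lemma block_choi (phi : M -> M) i j : block (choi phi) i j = phi (delta_mx i j).
Proof. exact: (block_sum_delta (fun i j => phi (delta_mx i j))). Qed.

Lemma block_trmx (x : MM) i j : block x^T i j = (block x j i)^T.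
Proof. by apply/matrixP => k l; rewrite !mxE. Qed.

Lemma sum_mxtens_index (V : nmodType) (F : 'I_(n * n) -> V) :
  \sum_p F p = \sum_i \sum_k F (mxtens_index (i, k)).
Proof.
rewrite pair_big (reindex (@mxtens_index n n)) /=; last first.
  by exists (@mxtens_unindex n n) => i _; rewrite ?mxtens_indexK ?mxtens_unindexK.
by apply: eq_bigr => -[].
Qed.

Lemma mxtrace_mul_block (x y : MM) :
  \tr (x *m y) = \sum_i \sum_j \tr (block x i j *m block y j i).
Proof.
rewrite /mxtrace sum_mxtens_index; apply: eq_bigr => i _.
under [RHS]eq_bigr do under eq_bigr do rewrite mxE.
rewrite exchange_big; apply: eq_bigr => k _ /=.
rewrite mxE sum_mxtens_index; apply: eq_bigr => j _; apply: eq_bigr => l _.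
by rewrite !mxE.
Qed.

Lemma mxtrace_trmx_mul m (x y : 'M[C]_m) : \tr (x^T *m y^T) = \tr (x *m y).
Proof. by rewrite -trmx_mul mxtrace_tr mxtrace_mulC. Qed.

Lemma adjoint_linear (alpha : M -> M) : linear (adjoint alpha).
Proof.
move=> c x y; apply/matrixP => i j; rewrite !mxE.
by rewrite mulmxDr -scalemxAr mxtraceD mxtraceZ.
Qed.

Lemma mxtrace_id_tens (alpha : M -> M) (x y : MM) : linear alpha ->
  \tr (id_tens alpha x *m y) = \tr (x *m id_tens (adjoint alpha) y).
Proof.
move=> lin; rewrite !mxtrace_mul_block; apply: eq_bigr => i _.
by apply: eq_bigr => j _; rewrite !block_id_tens adjointP.
Qed.

(** The inverse of the Choi correspondence; it lets an arbitrary matrix be used as the Choi matrix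
    of a linear map. *)
Definition unchoi (x : MM) (a : M) : M := \sum_i \sum_j a i j *: block x i j.

Lemma unchoi_linear (x : MM) : linear (unchoi x).
Proof.
move=> c a b; rewrite /unchoi scaler_sumr -big_split; apply: eq_bigr => i _ /=.
rewrite scaler_sumr -big_split; apply: eq_bigr => j _ /=.
by rewrite !mxE scalerDl scalerA.
Qed.

Lemma choi_unchoi (x : MM) : choi (unchoi x) = x.
Proof.
apply: block_inj => i j; rewrite block_choi /unchoi.
rewrite (bigD1 i) //= (bigD1 j) //= !big1.
- by rewrite !addr0 mxE !eqxx scale1r.
- by move=> k nk; rewrite big1 // => l _; rewrite mxE (negPf nk) scale0r.
- by move=> k nk; rewrite mxE (negPf nk) andbF scale0r.
Qed.

Lemma id_tens_choi (alpha phi : M -> M) :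
  id_tens alpha (choi phi) = choi (alpha \o phi).
Proof. by apply: block_inj => i j; rewrite block_id_tens !block_choi. Qed.

(** Transposition swaps the block indices and transposes each block, so the functional is a trace
    pairing up to one transpose. That transpose is why stability of P under transposition matters
    below. *)
Lemma tilde_choi (phi : M -> M) (x : MM) : tilde phi x = \tr ((choi phi)^T *m x).
Proof.
rewrite mxtrace_mul_block /tilde exchange_big; apply: eq_bigr => i _.
apply: eq_bigr => j _; rewrite block_trmx block_choi.
by rewrite -mxtrace_trmx_mul trmxK.
Qed.

Lemma mxtrace_choi_tens (phi : M -> M) (a b : M) : linear phi ->
  \tr (choi phi *m (a *t b)) = \tr (phi a^T *m b).
Proof.
move=> lin; rewrite -mxtrace_trmx_mul -tilde_choi trmx_tens tilde_tensmx //.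
by rewrite trmxK.
Qed.

Lemma psd_conjugate m p (A : 'M[C]_m) (B : 'M[C]_(p, m)) :
  psd A -> psd (B *m A *m B ^t*).
Proof.
move=> hA v; have := hA (B ^t* *m v).
by rewrite trmx_mul map_mxM /= trmxCK !mulmxA.
Qed.

Lemma ketbra_mul m p (B : 'M[C]_(p, m)) (v : 'cV[C]_m) :
  ketbra (B *m v) = B *m ketbra v *m B ^t*.
Proof. by rewrite /ketbra trmx_mul map_mxM /= !mulmxA. Qed.

Lemma ketbra_tens m p (u : 'cV[C]_m) (w : 'cV[C]_p) :
  ketbra u *t ketbra w = (u *t w) *m (u *t w) ^t*.
Proof.
by rewrite trmx_tens map_mxT tensmx_mul.
Qed.

Lemma psd_tens (a b : M) : psd a -> psd b -> psd (a *t b).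
Proof.
move=> /psd_sum_ketbra[u ->] /psd_sum_ketbra[w ->].
rewrite (linear_fun_sum (f := fun a => a *t _)); last first.
  by move=> c x y; apply/matrixP => k l; rewrite !mxE; ring.
apply: psd_sum => i _.
rewrite (linear_fun_sum (f := fun b => _ *t b)); last first.
  by move=> c x y; apply/matrixP => k l; rewrite !mxE; ring.
apply: psd_sum => j _; rewrite ketbra_tens; exact: psd_ketbra.
Qed.

(* The unnormalised maximally entangled vector \sum_i e_i (x) e_i. *)
Definition maxent : 'cV[C]_(n * n) :=
  \col_p ((mxtens_unindex p).1 == (mxtens_unindex p).2)%:R.

Lemma choi_id : choi id = ketbra maxent.
Proof.
apply: block_inj => i j; rewrite block_choi; apply/matrixP => k l.
rewrite !mxE big_ord1 !mxE !mxtens_indexK /= rmorph_nat -natrM mulnb.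
by rewrite (eq_sym i) (eq_sym j).
Qed.

(** The coordinates of v, reshaped into a square matrix a, act on the first leg: the sum of (a e_k)
    (x) e_k is v. *)
Lemma tensmx1_maxent (v : 'cV[C]_(n * n)) :
  v = ((\matrix_(i, k) v (mxtens_index (i, k)) 0) *t 1%:M) *m maxent.
Proof.
apply/colP => p; case: (mxtens_indexP p) => i k.
rewrite mxE sum_mxtens_index (bigD1 k) //= (bigD1 k) //= !big1.
- by rewrite !addr0 tensmxE !mxE !mxtens_indexK /= !eqxx !mulr1.
- move=> j nj; rewrite big1 // => l _.
  rewrite tensmxE !mxE !mxtens_indexK /=.
  by have [jl|] := eqVneq j l; rewrite ?mulr0 // -jl eq_sym (negPf nj) mulr0 mul0r.
- move=> l nl; rewrite tensmxE !mxE eq_sym (negPf nl) !(mulr0, mul0r) //.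
Qed.

(** The map iota (x) alpha touches the second leg only, so it commutes with multiplication on the
    first; elementary tensors suffice by linearity. *)
Lemma id_tens_mul_tens1 (alpha : M -> M) (a b : M) (x : MM) : linear alpha ->
  id_tens alpha ((a *t 1%:M) *m x *m (b *t 1%:M)) =
  (a *t 1%:M) *m id_tens alpha x *m (b *t 1%:M).
Proof.
move=> lin; rewrite (tens_blockE x).
have il := id_tens_linear lin.
have ml : linear (fun x : MM => (a *t 1%:M) *m x *m (b *t 1%:M)).
  by apply: (mulmx_linear _ _ (f := id)).
have h f : linear f -> 
   f (\sum_i \sum_j delta_mx i j *t block x i j) =
   \sum_i \sum_j f (delta_mx i j *t block x i j) :> MM.
  move=> fl; rewrite (linear_fun_sum fl); apply: eq_bigr => i _.
  exact: (linear_fun_sum fl).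
rewrite [LHS](h _ (linear_comp_fun il ml)) [RHS](h _ (linear_comp_fun ml il)) /=.
apply: eq_bigr => i _; apply: eq_bigr => j _.
by rewrite id_tens_tensmx // !tensmx_mul !(mulmx1, mul1mx) id_tens_tensmx.
Qed.

(** Since v = (a (x) 1) [maxent], the factors a (x) 1 come out, and iota (x) phi sends
    [ketbra maxent], the Choi matrix of the identity, to that of phi. *)
Lemma id_tens_ketbra (phi : M -> M) (v : 'cV[C]_(n * n)) : linear phi ->
  exists a : M, id_tens phi (ketbra v) =
    (a *t 1%:M) *m choi phi *m (a ^t* *t 1%:M).
Proof.
move=> lin; exists (\matrix_(i, k) v (mxtens_index (i, k)) 0).
rewrite [v in LHS]tensmx1_maxent ketbra_mul trmx_tens map_mxT trmx1 map_mx1.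
by rewrite id_tens_mul_tens1 // -choi_id id_tens_choi.
Qed.

End Blocks.

(** * Mapping cones, the cones P(B(H), K) and their trace duality *)

Section Duality.
Variables (C : numClosedFieldType) (n : nat).
Local Notation M := 'M[C]_n.
Local Notation MM := 'M[C]_(n * n).

Lemma positive_map_ketbra (phi : M -> M) : linear phi ->
  (forall u w, 0 <= \tr (phi (ketbra u) *m ketbra w)) -> positive_map phi.
Proof.
move=> lin h; split=> // x /psd_sum_ketbra[u ->]; rewrite (linear_fun_sum lin).
by apply: psd_sum => i _; apply/psdP => w; exact: h.
Qed.

Lemma mulmx_rank1_conjugate m p (v : 'cV[C]_p) (w : 'cV[C]_m) (x : 'M[C]_m) :
  v *m w ^t* *m x *m (v *m w ^t*) ^t* = \tr (x *m ketbra w) *: ketbra v.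
Proof.
rewrite trmx_mul map_mxM /= trmxCK !mulmxA -2!(mulmxA v).
rewrite [w ^t* *m x *m w]mx11_scalar -mxtrace_mul_ketbra.
by rewrite mul_mx_scalar -scalemxAl /ketbra !mulmxA.
Qed.

(* With phi (v v^* ) != 0 for some phi in K and u^* phi (v v^* ) u > 0, the map
   is a multiple of x |-> (w u^* ) phi ((v w^* ) x (v w^* )^* ) (w u^* )^*. *)
Lemma mapping_cone_rank1 (K : set (M -> M)) (w : 'cV[C]_n) : mapping_cone K ->
  K (fun x => \tr (x *m ketbra w) *: ketbra w).
Proof.
case=> Kpos [_ _ Kscale] [phi Kphi phi_neq0] _ Kconj.
have [lin pos] := Kpos _ Kphi.
have [v Pv0] : exists v, phi (ketbra v) <> 0.
  apply: contrapT => h; apply: phi_neq0; apply/funext => x.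
  apply: (polarization_eq0 lin) => v; apply: contrapT => nv.
  by apply: h; exists v.
have [u Pu0] : exists u, \tr (phi (ketbra v) *m ketbra u) <> 0.
  apply: contrapT => h; apply: Pv0; apply/matrixP => i j.
  rewrite mxE -mxtrace_mul_delta.
  apply: (polarization_eq0 (trmul_linear _)) => u; apply: contrapT => nu.
  by apply: h; exists u.
set c := \tr _ in Pu0.
have c_ge0 : 0 <= c by apply: (psdP _).1; apply: pos; exact: psd_ketbra.
have := Kscale c^-1 _ _ (Kconj _ (w *m u ^t*) (v *m w ^t*) Kphi).
rewrite invr_ge0 => /(_ c_ge0); congr (K _); apply/funext => x.
transitivity (c^-1 *: (w *m u ^t* *m phi (v *m w ^t* *m x *m (v *m w ^t*) ^t*)
    *m (w *m u ^t*) ^t*)); first by [].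
rewrite (mulmx_rank1_conjugate v w x) (linear_funZ lin) mulmx_rank1_conjugate.
rewrite -scalemxAl mxtraceZ scalerA -/c mulrCA mulVf ?mulr1 //.
exact/eqP.
Qed.

(** Each member of K is t o beta o t with beta in K, and it sends the transpose of x to the
    transpose of the image of x under iota (x) beta. This is where K = K^t enters. *)
Lemma Pcone_trmx (K : set (M -> M)) (x : MM) : K = transpose_cone K ->
  Pcone K x -> Pcone K x^T.
Proof.
move=> Kt Px alpha; rewrite Kt => -[beta Kbeta <-].
have -> : id_tens (fun y : M => (beta y^T)^T) x^T = (id_tens beta x)^T.
  by apply: block_inj => i j; rewrite block_id_tens !block_trmx block_id_tens trmxK.
exact/psd_tr/Px.
Qed.

Lemma Pcone_tens_ketbra (K : set (M -> M)) (u w : 'cV[C]_n) :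
  K `<=` @positive_map C n -> Pcone K (ketbra u *t ketbra w).
Proof.
move=> Kpos alpha /Kpos[lin pos]; rewrite id_tens_tensmx //.
by apply: psd_tens; [exact: psd_ketbra | exact/pos/psd_ketbra].
Qed.

Lemma trmx_ketbra m (u : 'cV[C]_m) : (ketbra u)^T = ketbra (map_mx Num.conj u).
Proof.
rewrite /ketbra trmx_mul; congr (_ *m _); first by rewrite -map_trmx trmxK.
by apply/matrixP => i j; rewrite !mxE conjCK.
Qed.

(** Testing with the rank-one map of K attached to w, paired with the tensor of ([ketbra u])^T and
    [ketbra w], gives [\tr (phi (ketbra u) *m ketbra w)] times the fourth power of the norm of w,
    which divides out. *)
Lemma Pcone_choi_positive (K : set (M -> M)) (phi : M -> M) :
  mapping_cone K -> linear phi -> Pcone K (choi phi) -> positive_map phi.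
Proof.
move=> hK lin Pphi; apply: positive_map_ketbra => // u w.
have [->|w0] := eqVneq w 0; first by rewrite /ketbra mul0mx mulmx0 mxtrace0.
have := Pphi _ (mapping_cone_rank1 w hK); rewrite id_tens_choi.
set alpha := fun x : M => _.
have alin : linear alpha.
  by move=> c x y; rewrite /alpha mulmxDl -scalemxAl mxtraceD mxtraceZ scalerDl scalerA.
move=> hpsd; have : 0 <= \tr (choi (alpha \o phi) *m ((ketbra u)^T *t ketbra w)).
  apply: mxtrace_mul_psd_ge0 => //; apply: psd_tens; first apply: psd_tr; exact: psd_ketbra.
rewrite mxtrace_choi_tens ?trmxK; last exact: linear_comp_fun.
rewrite /= /alpha -scalemxAl mxtraceZ pmulr_lge0 //.
rewrite mxtrace_mul_ketbra /ketbra mulmxA -mulmxA mxE big_ord1.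
suff : 0 < (w ^t* *m w) 0 0 by move=> ?; apply: mulr_gt0.
rewrite lt0r; apply/andP; split; last first.
  by rewrite mxE sumr_ge0 // => i _; rewrite !mxE mulrC mul_conjC_ge0.
apply: contra w0; rewrite mxE psumr_eq0 => [/allP h|i _]; last first.
  by rewrite !mxE mulrC mul_conjC_ge0.
apply/eqP/colP => i; have := h i (mem_index_enum _).
by rewrite !mxE mulrC mul_conjC_eq0 => /eqP.
Qed.

(** P contains all tensors of two rank-one positive matrices. Conjugating w undoes the transposition
    that the functional applies to the second leg. *)
Lemma tilde_ge0_positive (K : set (M -> M)) (phi : M -> M) :
  K `<=` @positive_map C n -> linear phi ->
  (forall x, Pcone K x -> 0 <= tilde phi x) -> positive_map phi.
Proof.
move=> Kpos lin h; apply: positive_map_ketbra => // u w.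
have := h _ (Pcone_tens_ketbra u (map_mx Num.conj w) Kpos).
by rewrite tilde_tensmx // -trmx_ketbra trmxK.
Qed.

(** The half-space defined by x is a closed convex cone, and moving the adjoint across the trace
    shows that it contains the generators of C^K. *)
Lemma Pcone_CK_ge0 (K : set (M -> M)) (x z : MM) : K `<=` @positive_map C n ->
  Pcone K x -> CK K z -> 0 <= \tr (x *m z).
Proof.
move=> Kpos Px CKz; apply: (CKz [set y | 0 <= \tr (x *m y)]); split.
- split=> [|y y'|c y c0] /=; rewrite ?mulmx0 ?mxtrace0 //.
    by rewrite mulmxDr mxtraceD; exact: addr_ge0.
  by rewrite -scalemxAr mxtraceZ; exact: mulr_ge0.
- apply: (preimage_closed _ (@closed_ge0 C)) => y _.
  exact: (linear_continuous_mx (trmul_linear x)).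
- move=> _ [alpha Kalpha [q qpsd <-]] /=; have [lin _] := Kpos _ Kalpha.
  by rewrite -mxtrace_id_tens //; apply: mxtrace_mul_psd_ge0 => //; exact: Px.
Qed.

Lemma CK_id_tens_adjoint (K : set (M -> M)) (alpha : M -> M) (q : MM) :
  K alpha -> psd q -> CK K (id_tens (adjoint alpha) q).
Proof.
by move=> Ka qpsd D [_ _]; apply; exists alpha => //; exists q.
Qed.

Lemma sharp_adjoint (K : set (M -> M)) (phi : M -> M) : mapping_cone K ->
  linear phi -> Pcone K (choi phi) -> sharp K (adjoint phi).
Proof.
move=> hK lin Pphi; have Kpos : K `<=` @positive_map C n by case: hK.
have [_ pos] := Pcone_choi_positive hK lin Pphi.
split=> [|z CKz].
  split=> [|y ypsd]; first exact: adjoint_linear.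
  apply/psdP => w; rewrite mxtrace_mulC -adjointP //.
  by apply: mxtrace_mul_psd_ge0 => //; apply/pos/psd_ketbra.
apply/psdP => v; rewrite mxtrace_mulC -mxtrace_id_tens //.
apply: (Pcone_CK_ge0 Kpos) CKz => alpha Kalpha.
have [alin _] := Kpos _ Kalpha.
have [a ->] := id_tens_ketbra v lin.
rewrite id_tens_mul_tens1 //.
have := psd_conjugate (a *t 1%:M) (Pphi _ Kalpha).
by rewrite trmx_tens map_mxT trmx1 map_mx1.
Qed.

Lemma Lpositive_sharpE (K : set (M -> M)) (psi : M -> M) :
  mapping_cone K -> K = transpose_cone K ->
  Lpositive (sharp K) psi <-> linear psi /\ Pcone K (choi psi).
Proof.
move=> hK Kt; have Kpos : K `<=` @positive_map C n by case: hK.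
split=> [[[lin _] h]|[lin Ppsi]].
  split=> //; rewrite -[choi psi]trmxK; apply: Pcone_trmx => // alpha Ka.
  have [alin _] := Kpos _ Ka.
  (* The test matrix [id_tens (adjoint alpha) (ketbra v)] lies in C^K, so every member of [sharp K]
     is nonnegative on it. *)
  apply/psdP => v; rewrite mxtrace_id_tens // -tilde_choi; apply: h => beta [_].
  by apply; apply: CK_id_tens_adjoint => //; exact: psd_ketbra.
split; first exact: Pcone_choi_positive hK lin Ppsi.
move=> x Px; rewrite tilde_choi -(choi_unchoi (choi psi)^T).
set phi := unchoi _; have plin : linear phi by exact: unchoi_linear.
have : sharp K (adjoint phi).
  by apply: sharp_adjoint => //; rewrite choi_unchoi; exact: Pcone_trmx.
(* Evaluated at the maximally entangled vector, positivity of [id_tens (adjoint phi) x] is the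
   pairing of x with the Choi matrix of phi, which is the transpose of that of psi. *)
move=> /Px/psdP/(_ (maxent C n)); rewrite -choi_id mxtrace_mulC.
by rewrite -mxtrace_id_tens // id_tens_choi.
Qed.

Lemma dual_LpositiveE (K : set (M -> M)) (phi : M -> M) :
  mapping_cone K -> K = transpose_cone K ->
  dual_cone (Lpositive K) phi <-> linear phi /\ Pcone K (choi phi).
Proof.
move=> hK Kt; have Kpos : K `<=` @positive_map C n by case: hK.
split=> [[lin h]|[lin Pphi]]; split=> //; last first.
  move=> psi [_ hpsi]; rewrite -mxtrace_trmx_mul mxtrace_mulC -tilde_choi.
  exact/hpsi/Pcone_trmx.
move=> alpha Ka; have [alin _] := Kpos _ Ka.
(* Read as a Choi matrix, the test matrix defines a K-positive map: its pairing with P moves back to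
   iota (x) alpha. *)
apply/psdP => v; rewrite mxtrace_id_tens // -[id_tens _ _]choi_unchoi.
apply: h; set psi := unchoi _.
have psilin : linear psi by exact: unchoi_linear.
have hpsi x : Pcone K x -> 0 <= tilde psi x.
  move=> Px; rewrite tilde_choi choi_unchoi -mxtrace_trmx_mul trmxK mxtrace_mulC.
  rewrite -mxtrace_id_tens //; apply: (psdP _).1; exact: (Pcone_trmx Kt Px).
by split=> //; exact: tilde_ge0_positive Kpos psilin hpsi.
Qed.

End Duality.

(* The two dual cone identities over R[i] *)
Local Close Scope sesquilinear_scope.
Local Open Scope complex_scope.

Theorem theorem12 (R : realType) (n : nat)
    (K : set ('M[R[i]]_n -> 'M[R[i]]_n))
    (hK : mapping_cone K) (hKt : K = transpose_cone K) :
  dual_cone (Lpositive K) = Lpositive (sharp K) /\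
  Lpositive K = dual_cone (Lpositive (sharp K)).
Proof.
have Kpos : K `<=` @positive_map _ n by case: hK.
split; apply/seteqP; split=> phi.
- by move=> /(dual_LpositiveE _ hK hKt)/(Lpositive_sharpE _ hK hKt).
- by move=> /(Lpositive_sharpE _ hK hKt)/(dual_LpositiveE _ hK hKt).
- move=> [[lin _] h]; split=> // psi /(Lpositive_sharpE _ hK hKt)[_ Ppsi].
  by rewrite -mxtrace_trmx_mul -tilde_choi; exact/h/Pcone_trmx.
(* For x in P, the transpose of x is again in P, hence is the Choi matrix of a map in
   [Lpositive (sharp K)]; pairing phi with that map gives the sign of [tilde phi x]. *)
- move=> [lin h].
  have ht x : Pcone K x -> 0 <= tilde phi x.
    move=> Px; rewrite tilde_choi -mxtrace_trmx_mul trmxK -[x^T]choi_unchoi.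
    apply: h; apply/(Lpositive_sharpE _ hK hKt); split; first exact: unchoi_linear.
    by rewrite choi_unchoi; exact: Pcone_trmx.
  by split=> //; exact: tilde_ge0_positive Kpos lin ht.
Qed.
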